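(* Let $M\in\mathbb R^{n\times n}$, $\mathbf b\in\mathbb R^n$, $G(\mathbf x)=M\mathbf x+\mathbf b$, and suppose $A=I-M$ is nonsingular. Let $\mathbf x_0\in\mathbb R^n$ be an initial guess, $\mathbf r_0=\mathbf b-A\mathbf x_0$, and let $k>0$ be an integer. Let $\Theta\in\mathbb R^{s\times n}$ be a sketching matrix that is an $\varepsilon$-embedding for $\mathcal K_k(A,\mathbf r_0)=\operatorname{span}\{\mathbf r_0,A\mathbf r_0,\ldots,A^{k-1}\mathbf r_0\}$. Let $\mathbf x_j^{\mathrm{sGMRES}}$ denote the iterates of sketched GMRES applied to $A\mathbf x=\mathbf b$ with initial guess $\mathbf x_0$, and $\mathbf r_j^{\mathrm{sGMRES}}=\mathbf b-A\mathbf x_j^{\mathrm{sGMRES}}$. Let $\mathbf x_j^{\mathrm{sAA}}$ denote the iterates of untruncated sketched Anderson acceleration applied to the fixed-point map $G$ with the same initial guess $\mathbf x_0$ and the same $\Theta$, with coefficients $\alpha_i^{(j)}$ ($0\le i\le j$) at step $j$. Assume that $$\mathbf r_{k-1}^{\mathrm{sGMRES}}\neq 0\quad\text{and}\quad \|\mathbf r_j^{\mathrm{sGMRES}}\|_\Theta<\|\mathbf r_{j-1}^{\mathrm{sGMRES}}\|_\Theta\quad\text{for } j=1,\ldots,k.$$ Then $$\sum_{i=0}^{k}\alpha_i^{(k)}\mathbf x_i^{\mathrm{sAA}}=\mathbf x_k^{\mathrm{sGMRES}}\qquad\text{and}\qquad \mathbf x_{k+1}^{\mathrm{sAA}}=G\!\left(\mathbf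 x_k^{\mathrm{sGMRES}}\right).$$
   Context: **Sketched norm and embedding.** For $\Theta\in\mathbb R^{s\times n}$ and $\mathbf v\in\mathbb R^n$, write $\|\mathbf v\|_\Theta=\|\Theta\mathbf v\|_2$. The matrix $\Theta$ is an $\varepsilon$-embedding for a subspace $\mathcal V\subset\mathbb R^n$ (with $\varepsilon$ a real distortion parameter) if $(1-\varepsilon)\|\mathbf v\|_2^2\le\|\Theta\mathbf v\|_2^2\le(1+\varepsilon)\|\mathbf v\|_2^2$ for all $\mathbf v\in\mathcal V$. **Krylov subspaces.** $\mathcal K_j(A,\mathbf r_0)=\operatorname{span}\{\mathbf r_0,A\mathbf r_0,\ldots,A^{j-1}\mathbf r_0\}$ for $j\ge1$, and $\mathcal K_0(A,\mathbf r_0)=\{0\}$. **Sketched GMRES.** The iterates are $\mathbf x_j^{\mathrm{sGMRES}}=\mathbf x_0+\mathbf z_j$, where $\mathbf z_j=\operatorname{arg\,min}_{\mathbf z\in\mathcal K_j(A,\mathbf r_0)}\|\mathbf r_0-A\mathbf z\|_\Theta$; in particular $\mathbf x_0^{\mathrm{sGMRES}}=\mathbf x_0$. **Untruncated sketched Anderson acceleration (sAA).** Set $\mathbf x_0^{\mathrm{sAA}}=\mathbf x_0$. At step $j\ge0$, given $\mathbf x_0^{\mathrm{sAA}},\ldots,\mathbf x_j^{\mathrm{sAA}}$, put $\mathbf r_i^{\mathrm{sAA}}=G(\mathbf x_i^{\mathrm{sAA}})-\mathbf x_i^{\mathrm{sAA}}$ for $0\le i\le j$, let $$(\alpha_0^{(j)},\ldots,\alpha_j^{(j)})=\operatorname{arg\,min}\Big\{\Big\|\sum_{i=0}^j\alpha_i\mathbf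 r_i^{\mathrm{sAA}}\Big\|_\Theta:\ \boldsymbol\alpha\in\mathbb R^{j+1},\ \sum_{i=0}^j\alpha_i=1\Big\},$$ and set $\mathbf x_{j+1}^{\mathrm{sAA}}=\sum_{i=0}^j\alpha_i^{(j)}G(\mathbf x_i^{\mathrm{sAA}})$. ''Untruncated'' means that all previous iterates $0,\ldots,j$ are used at step $j$. In both methods, $\operatorname{arg\,min}$ denotes a minimizer of the stated least-squares problem. *)

(* Defs.v *)
From mathcomp Require Import all_boot all_order all_algebra reals.
Set Implicit Arguments.
Unset Strict Implicit.
Unset Printing Implicit Defensive.
Import Order.TTheory GRing.Theory Num.Theory.
Local Open Scope ring_scope.

(* The norm MathComp-Analysis puts on matrices is the max norm, hence this
   explicit Euclidean norm. *)
Definition norm2 (R : realType) (n : nat) (v : 'cV[R]_n) : R :=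
  Num.sqrt (\sum_(i < n) v i 0 ^+ 2).

Definition sketched_norm (R : realType) (s n : nat) (Theta : 'M[R]_(s, n))
  (v : 'cV[R]_n) : R := norm2 (Theta *m v).

Definition is_embedding (R : realType) (s n : nat) (eps : R)
  (Theta : 'M[R]_(s, n)) (V : {vspace 'cV[R]_n}) : Prop :=
  forall v, v \in V ->
    (1 - eps) * norm2 v ^+ 2 <= norm2 (Theta *m v) ^+ 2 <=
      (1 + eps) * norm2 v ^+ 2.

Definition krylov (R : realType) (n : nat) (A : 'M[R]_n) (r : 'cV[R]_n)
  (j : nat) : {vspace 'cV[R]_n} :=
  <<[seq A ^+ i *m r | i <- iota 0 j]>>%VS.

(* [x] is some minimizer of [f] over [S]; uniqueness is not required. *)
Definition is_argmin (R : realType) (T : Type) (S : T -> Prop) (f : T -> R)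
  (x : T) : Prop :=
  S x /\ forall y, S y -> f x <= f y.

Definition sGMRES_iterates (R : realType) (s n : nat) (Theta : 'M[R]_(s, n))
  (A : 'M[R]_n) (b x0 : 'cV[R]_n) (x : nat -> 'cV[R]_n) : Prop :=
  let r0 := b - A *m x0 in
  forall j : nat, exists2 z : 'cV[R]_n,
    is_argmin (fun z => z \in krylov A r0 j)
      (fun z => sketched_norm Theta (r0 - A *m z)) z
    & x j = x0 + z.

(* [alpha j] is the vector of the j+1 coefficients used at step j. *)
Definition sAA_iterates (R : realType) (s n : nat) (Theta : 'M[R]_(s, n))
  (G : 'cV[R]_n -> 'cV[R]_n) (x0 : 'cV[R]_n)
  (x : nat -> 'cV[R]_n) (alpha : forall j : nat, 'cV[R]_j.+1) : Prop :=
  x 0%N = x0 /\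
  forall j : nat,
    is_argmin (fun a : 'cV[R]_j.+1 => \sum_(i < j.+1) a i 0 = 1)
      (fun a => sketched_norm Theta
                  (\sum_(i < j.+1) a i 0 *: (G (x i) - x i)))
      (alpha j)
    /\ x j.+1 = \sum_(i < j.+1) alpha j i 0 *: G (x i).

(* Main.v *)
(* Write d_j for the sketched sGMRES residual norm at step j.  The strict decrease
   of d_0, ..., d_k makes Theta A injective on K_k(A, r0): a vector of
   K_(j+1) outside K_j killed by Theta A could be used to move the minimizer over
   K_(j+1) into K_j without changing its residual norm, so that d_j <= d_(j+1).
   Hence the sGMRES minimizers are unique up to step k.  The affine hull of
   x_0^AA, ..., x_j^AA is x_0 + K_j for all j <= k, by induction: step j
   of sAA is then the sGMRES problem over K_j, so x_(j+1)^AA = x_0 + z_j + (r0 - A z_j)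
   with z_j the sGMRES correction, and this increment leaves K_j because otherwise
   K_j would be A-invariant, contradicting d_(j+1) < d_j. *)
Require Import Defs.
From mathcomp Require Import all_boot all_order all_algebra reals.
From mathcomp Require Import ring lra.
Set Implicit Arguments.
Unset Strict Implicit.
Unset Printing Implicit Defensive.
Import Order.TTheory GRing.Theory Num.Theory.
Local Open Scope ring_scope.

(** * Euclidean norm and its strict convexity *)

Lemma norm2_ge0 (R : realType) (n : nat) (v : 'cV[R]_n) : 0 <= norm2 v.
Proof. exact: sqrtr_ge0. Qed.

Lemma sqr_norm2 (R : realType) (n : nat) (v : 'cV[R]_n) :
  norm2 v ^+ 2 = \sum_(i < n) v i 0 ^+ 2.
Proof. by rewrite sqr_sqrtr// sumr_ge0// => i _; exact: sqr_ge0. Qed.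

Lemma sqr_norm2_le0 (R : realType) (n : nat) (v : 'cV[R]_n) :
  norm2 v ^+ 2 <= 0 -> v = 0.
Proof.
rewrite sqr_norm2 => v0; apply/matrixP => i j; rewrite ord1 mxE.
have sq0 (l : 'I_n) : true -> 0 <= v l 0 ^+ 2 by rewrite sqr_ge0.
have /eqP v0' : \sum_(i < n) v i 0 ^+ 2 == 0 by rewrite eq_le v0 sumr_ge0.
by apply/eqP; rewrite -sqrf_eq0 (psumr_eq0P sq0 v0').
Qed.

Lemma norm2_parallelogram (R : realType) (n : nat) (u v : 'cV[R]_n) :
  norm2 (2^-1 *: (u + v)) ^+ 2 + norm2 (2^-1 *: (u - v)) ^+ 2 =
  2^-1 * (norm2 u ^+ 2 + norm2 v ^+ 2).
Proof.
rewrite !sqr_norm2 -!big_split mulr_sumr; apply: eq_bigr => i _ /=.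
by rewrite !mxE; field.
Qed.

(** Strict convexity: by the parallelogram law a midpoint at least as long as its two equally long
    endpoints leaves no room for their difference. *)
Lemma norm2_midpoint_eq (R : realType) (n : nat) (u v : 'cV[R]_n) :
  norm2 u = norm2 v -> norm2 u <= norm2 (2^-1 *: (u + v)) -> u = v.
Proof.
move=> uv mid; have := norm2_parallelogram u v; rewrite -uv => E.
have mid2 : norm2 u ^+ 2 <= norm2 (2^-1 *: (u + v)) ^+ 2.
  by rewrite ler_sqr ?nnegrE ?norm2_ge0.
have /sqr_norm2_le0 /eqP : norm2 (2^-1 *: (u - v)) ^+ 2 <= 0 by lra.
by rewrite scaler_eq0 invr_eq0 pnatr_eq0 /= subr_eq0 => /eqP.
Qed.

(** * Krylov subspaces as an increasing chain *)

Section Krylov.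
Variables (R : realType) (n : nat) (A : 'M[R]_n) (r : 'cV[R]_n).
Local Notation K := (krylov A r).

Lemma krylovS j : K j.+1 = (K j + <[A ^+ j *m r]>)%VS.
Proof. by rewrite /krylov -[j.+1]addn1 iotaD map_cat span_cat /= span_seq1. Qed.

Lemma krylov_sub i j : (i <= j)%N -> (K i <= K j)%VS.
Proof.
move=> /subnK <-; elim: (j - i)%N => [|d IH]; first exact: subvv.
by rewrite addSn krylovS; apply: subv_trans IH (addvSl _ _).
Qed.

Lemma krylov0 z : (z \in K 0) = (z == 0).
Proof. by rewrite /krylov /= span_nil memv0. Qed.

Lemma krylovSP j z :
  reflect (exists2 y, y \in K j & exists c, z = y + c *: (A ^+ j *m r))
          (z \in K j.+1).
Proof.
rewrite krylovS; apply: (iffP memv_addP) => [[y yK [_ /vlineP[c ->] ->]]|].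
  by exists y => //; exists c.
move=> [y yK [c ->]]; exists y => //; exists (c *: (A ^+ j *m r)) => //.
by apply/vlineP; exists c.
Qed.

Lemma krylov_start j : r \in K j.+1.
Proof.
apply: (subvP (@krylov_sub 1 _ _)) => //; apply/krylovSP; exists 0.
  exact: mem0v.
by exists 1; rewrite expr0 mul1mx scale1r add0r.
Qed.

Lemma mulmx_krylov j z : z \in K j -> A *m z \in K j.+1.
Proof.
elim: j z => [|j IH] z.
  by rewrite krylov0 => /eqP ->; rewrite mulmx0 mem0v.
case/krylovSP => y /IH yK [c ->]; apply/krylovSP; exists (A *m y) => //.
by exists c; rewrite mulmxDr -scalemxAr exprS mulmxA.
Qed.

(** K_(j+1) exceeds K_j by at most one dimension, so any [u] in the gap can replace A^j r as the
    extra generator. *)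
Lemma krylov_exchange j u z :
  u \in K j.+1 -> u \notin K j -> z \in K j.+1 ->
  exists c, z - c *: u \in K j.
Proof.
case/krylovSP => y yK [c ->] uNK /krylovSP[y' y'K [c' ->]].
have c0 : c != 0.
  by apply: contraNneq uNK => ->; rewrite scale0r addr0.
exists (c' / c); rewrite scalerDr scalerA divfK// opprD addrACA subrr addr0.
by rewrite rpredB// rpredZ.
Qed.

(** The new generator A^j r is A applied to A^(j-1) r, which lies in K_j only for positive [j]; K_0
    is always invariant. *)
Lemma krylov_invariant j :
  (0 < j)%N -> (forall z, z \in K j -> A *m z \in K j) -> (K j.+1 <= K j)%VS.
Proof.
case: j => // j _ KA; rewrite krylovS subv_add subvv /= -memvE exprS -mulmxA.
by apply: KA; rewrite krylovS (subvP (addvSr _ _))// memv_line.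
Qed.

End Krylov.

(** * Consequences of strictly decreasing sketched residuals *)

Section StrictDecrease.
Variables (R : realType) (n s : nat) (A : 'M[R]_n) (r : 'cV[R]_n).
Variables (Theta : 'M[R]_(s, n)) (k : nat) (z : nat -> 'cV[R]_n).
Local Notation K := (krylov A r).
Local Notation F := (fun y => sketched_norm Theta (r - A *m y)).
Hypothesis zmin : forall j, is_argmin (fun y => y \in K j) F (z j).
Hypothesis decr : forall j, (j < k)%N -> F (z j.+1) < F (z j).

Lemma residual_gap j y : (j < k)%N -> y \in K j -> F y != F (z j.+1).
Proof.
move=> jk yK; apply/eqP => E.
by have := lt_le_trans (decr jk) ((zmin j).2 _ yK); rewrite E ltxx.
Qed.

Lemma krylov_strict j : (j < k)%N -> ~~ (K j.+1 <= K j)%VS.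
Proof.
move=> jk; apply/negP => /subvP KK.
by have := residual_gap jk (KK _ (zmin j.+1).1); rewrite eqxx.
Qed.

Lemma minimizer_new j : (j < k)%N -> z j.+1 \notin K j.
Proof. by move=> jk; apply/negP => /(residual_gap jk); rewrite eqxx. Qed.

Lemma sketch_inj j y :
  (j <= k)%N -> y \in K j -> Theta *m (A *m y) = 0 -> y = 0.
Proof.
elim: j => [_|j IH jk yK y0]; first by rewrite krylov0 => /eqP.
have [yKj|yNK] := boolP (y \in K j); first exact: IH (ltnW jk) yKj y0.
have [c zK] := krylov_exchange yK yNK (zmin j.+1).1.
have := residual_gap jk zK; rewrite /sketched_norm !mulmxBr.
by rewrite -!scalemxAr y0 scaler0 subr0 eqxx.
Qed.

(** Two minimizers and their midpoint share one residual norm, so strict convexity equates the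
    sketched residuals and [sketch_inj] then equates the minimizers. *)
Lemma minimizer_uniq j y :
  (j <= k)%N -> is_argmin (fun y => y \in K j) F y -> y = z j.
Proof.
move=> jk [yK ymin]; have [zK zle] := zmin j.
have E : F y = F (z j) by apply/eqP; rewrite eq_le ymin// zle.
have mK : 2^-1 *: (y + z j) \in K j by rewrite rpredZ// rpredD.
have Em : Theta *m (r - A *m (2^-1 *: (y + z j))) =
    2^-1 *: (Theta *m (r - A *m y) + Theta *m (r - A *m z j)).
  rewrite -mulmxDr -scalemxAr [RHS]scalemxAr; congr (_ *m _).
  by apply/matrixP => i l; rewrite mulmxDr !mxE; field.
have := ymin _ mK; rewrite /sketched_norm Em => /(norm2_midpoint_eq E) /eqP.
rewrite -subr_eq0 -mulmxBr opprB addrC addrA subrK -mulmxBr => /eqP D0.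
apply/esym/eqP; rewrite -subr_eq0; apply/eqP.
by apply: sketch_inj jk _ D0; rewrite rpredB.
Qed.

Lemma increment_mem j : z j + (r - A *m z j) \in K j.+1.
Proof.
have zK := (zmin j).1.
rewrite rpredD ?rpredB ?krylov_start ?mulmx_krylov//.
exact: (subvP (krylov_sub _ _ (leqnSn j))).
Qed.

Lemma increment_new j : (j < k)%N -> z j + (r - A *m z j) \notin K j.
Proof.
move=> jk; have zK := (zmin j).1; apply/negP; rewrite rpredDl// => dK.
move/negP: (krylov_strict jk); apply.
(* For index 0 the increment is r itself, and r in K_0 already gives K_1 inside K_0; invariance is
   of use only from index 1 on. *)
case: j => [|j] in jk zK dK *.
  move: dK; rewrite (eqP (_ : z 0 == 0)) -?(krylov0 A r)//.
  by rewrite mulmx0 subr0 krylovS expr0 mul1mx subv_add subvv -memvE.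
apply: krylov_invariant => // y yK.
have AzK : A *m z j.+1 \in K j.+1.
  by rewrite -(subKr r (A *m _)) rpredB// krylov_start.
(* K_(j+1) is K_j plus the line of [z j.+1], and A maps both into K_(j+1). *)
have [c yzK] := krylov_exchange zK (minimizer_new (ltnW jk)) yK.
rewrite -(subrK (c *: z j.+1) y) mulmxDr -scalemxAr.
by apply: rpredD; [exact: mulmx_krylov yzK|exact: rpredZ].
Qed.

End StrictDecrease.

(** * Anderson iterates and the affine space x0 + K_j *)

Lemma anderson_residual (R : realType) (n m : nat) (M : 'M[R]_n)
    (b x0 : 'cV[R]_n) (x : nat -> 'cV[R]_n) (a : 'cV[R]_m) :
  \sum_(i < m) a i 0 = 1 ->
  \sum_(i < m) a i 0 *: (M *m x i + b - x i) =
  b - (1%:M - M) *m x0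
    - (1%:M - M) *m (\sum_(i < m) a i 0 *: x i - x0).
Proof.
move=> a1; rewrite mulmxBr opprB addrA subrK.
(* As the weights sum to 1, [b] can be spread over the sum and matched with G(x) - x = b - A x
   termwise. *)
have -> : b - (1%:M - M) *m (\sum_(i < m) a i 0 *: x i) =
    \sum_(i < m) a i 0 *: b - (1%:M - M) *m (\sum_(i < m) a i 0 *: x i).
  by rewrite -scaler_suml a1 scale1r.
rewrite mulmx_sumr -sumrB.
apply: eq_bigr => i _; rewrite -scalemxAr -scalerBr mulmxBl mul1mx.
by congr (_ *: _); rewrite opprB addrCA addrA.
Qed.

Section Anderson.
Variables (R : realType) (n s : nat) (M : 'M[R]_n) (b x0 : 'cV[R]_n).
Variables (Theta : 'M[R]_(s, n)) (k : nat) (z x : nat -> 'cV[R]_n).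
Variable alpha : forall j : nat, 'cV[R]_j.+1.
Let A := 1%:M - M.
Let r := b - A *m x0.
Let G := fun x : 'cV[R]_n => M *m x + b.
Local Notation K := (krylov A r).
Local Notation F := (fun y => sketched_norm Theta (r - A *m y)).
Hypothesis zmin : forall j, is_argmin (fun y => y \in K j) F (z j).
Hypothesis decr : forall j, (j < k)%N -> F (z j.+1) < F (z j).
Hypothesis xalpha : sAA_iterates Theta G x0 x alpha.

Definition affine_hull_krylov j :=
  (forall i, (i <= j)%N -> x i - x0 \in K j) /\
  (forall y, y \in K j -> exists2 a : 'cV[R]_j.+1,
     \sum_(i < j.+1) a i 0 = 1 & \sum_(i < j.+1) a i 0 *: x i - x0 = y).

(** Affine weights on the iterates sweep out exactly the corrections in K_j, so both methods
    minimize the same residual, and the minimizing correction is unique. *)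
Lemma anderson_combination j : (j <= k)%N -> affine_hull_krylov j ->
  \sum_(i < j.+1) alpha j i 0 *: x i - x0 = z j.
Proof.
move=> jk [xK Kx]; have [[a1 amin] _] := xalpha.2 j.
apply: (minimizer_uniq zmin decr jk); split.
  rewrite -[x0]scale1r -a1 scaler_suml -sumrB rpred_sum// => i _.
  by rewrite -scalerBr rpredZ// xK// -ltnS.
move=> y /Kx[a a1' <-].
by have := amin a a1'; rewrite /G !(anderson_residual M b x0).
Qed.

Lemma anderson_next j :
  x j.+1 = G (\sum_(i < j.+1) alpha j i 0 *: x i).
Proof.
have [[a1 _] ->] := xalpha.2 j; rewrite /G mulmx_sumr.
rewrite -[b in RHS]scale1r -a1 scaler_suml -big_split /=.
by apply: eq_bigr => i _; rewrite scalerDr scalemxAr.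
Qed.

Lemma anderson_affine_hull j : (j <= k)%N -> affine_hull_krylov j.
Proof.
have x0E := xalpha.1.
elim: j => [_|j IH jk].
  split=> [i|y]; first by rewrite leqn0 => /eqP ->; rewrite x0E subrr mem0v.
  rewrite krylov0 => /eqP ->; exists (const_mx 1).
    by rewrite big_ord1 mxE.
  by rewrite big_ord1 mxE scale1r x0E subrr.
have H := IH (ltnW jk); have [xK Kx] := H.
(* Applying G to the combined point x0 + z_j adds the residual at that point. *)
have xS : x j.+1 - x0 = z j + (r - A *m z j).
  rewrite anderson_next -(anderson_combination (ltnW jk) H).
  set y := \sum_(i < _) _; rewrite /G /r /A mulmxBr !mulmxBl !mul1mx.
  by apply/matrixP => i l; rewrite !mxE; ring.
split=> [i|y yK].
  rewrite leq_eqVlt ltnS => /orP[/eqP ->|ij]; first by rewrite xS (increment_mem zmin).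
  exact: (subvP (krylov_sub _ _ (leqnSn j)) _ (xK i ij)).
have [c /Kx[a a1 ay]] :=
  krylov_exchange (increment_mem zmin j) (increment_new zmin decr jk) yK.
(* [a0] represents x0 itself; subtracting c times it offsets the weight c put on the new iterate and
   keeps the total at 1. *)
have [a0 a01 a0y] := Kx 0 (mem0v _).
have widenE i : widen_ord (leqnSn j.+1) i = lift ord_max i.
  exact/val_inj/esym/lift_max.
exists (\col_i if unlift ord_max i is Some l then a l 0 - c * a0 l 0 else c).
  rewrite big_ord_recr /= !mxE unlift_none.
  under eq_bigr => i _ do rewrite widenE mxE liftK.
  by rewrite sumrB -mulr_sumr a1 a01 mulr1 subrK.
rewrite big_ord_recr /= !mxE unlift_none.
under eq_bigr => i _ do rewrite widenE mxE liftK ?lift_max scalerBl -scalerA.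
rewrite sumrB -scaler_sumr (subr0_eq a0y).
rewrite -(subrK (c *: (z j + (r - A *m z j))) y) -ay -xS.
by rewrite scalerBr [LHS]addrAC [X in X + _ = _]addrAC [RHS]addrA [RHS]addrAC.
Qed.

End Anderson.

Theorem theorem1 (R : realType) (n s : nat) (M : 'M[R]_n) (b x0 : 'cV[R]_n)
  (Theta : 'M[R]_(s, n)) (eps : R) (k : nat)
  (xGMRES xAA : nat -> 'cV[R]_n) (alpha : forall j : nat, 'cV[R]_j.+1) :
  let G := fun x : 'cV[R]_n => M *m x + b in
  let A := 1%:M - M in
  let r0 := b - A *m x0 in
  let rGMRES := fun j : nat => b - A *m xGMRES j in
  A \in unitmx ->
  (0 < k)%N ->
  is_embedding eps Theta (krylov A r0 k) ->
  sGMRES_iterates Theta A b x0 xGMRES ->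
  sAA_iterates Theta G x0 xAA alpha ->
  rGMRES k.-1 <> 0 ->
  (forall j : nat, (1 <= j <= k)%N ->
     sketched_norm Theta (rGMRES j) < sketched_norm Theta (rGMRES j.-1)) ->
  \sum_(i < k.+1) alpha k i 0 *: xAA i = xGMRES k
  /\ xAA k.+1 = G (xGMRES k).
Proof.
move=> G A r0 rG _ _ _ gmres aa _ decr.
(* Recovers as a function of j the corrections that [sGMRES_iterates] only asserts to exist. *)
pose z j := xGMRES j - x0.
have zmin j : is_argmin (fun y => y \in krylov A r0 j)
    (fun y => sketched_norm Theta (r0 - A *m y)) (z j).
  by have [y ymin xE] := gmres j; rewrite /z xE addrC addKr.
have rGE j : rG j = r0 - A *m z j.
  by rewrite /rG /r0 /z mulmxBr opprB addrA subrK.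
have decrz j : (j < k)%N ->
    sketched_norm Theta (r0 - A *m z j.+1) < sketched_norm Theta (r0 - A *m z j).
  by move=> jk; rewrite -!rGE; exact: decr.
have E : \sum_(i < k.+1) alpha k i 0 *: xAA i = xGMRES k.
  apply: (addIr (- x0)).
  exact: (anderson_combination zmin decrz aa (leqnn k)
            (anderson_affine_hull zmin decrz aa (leqnn k))).
by split=> //; rewrite (anderson_next aa) E.
Qed.
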